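(* Consider the network revenue management problem, its optimal value function $v^*$, a baseline approximation $\psi_t$, $t=1,\dots,\tau$, and a family of basis functions $\phi(\cdot;\vec\beta)$, $\vec\beta\in\mathbb{R}^I$, as described in the context. Assume there exist a finite number $K^*<\infty$ and parameters $\xi^*_t\in\mathbb{R}$, $V^*_{t,k}\in\mathbb{R}$, $\vec\beta^*_k\in\mathbb{R}^I$ ($t=1,\dots,\tau$, $k=1,\dots,K^*$) such that $$v^*_t(\vec x)=\psi_t(\vec x)+\xi^*_t-\sum_{k=1}^{K^*}V^*_{t,k}\,\phi(\vec x;\vec\beta^*_k)\qquad\text{for all }t=1,\dots,\tau,\ \vec x\in\mathcal{X}_t.$$ Let $\{\hat{\vec\beta}_k\}_{k=1}^{\hat K}\subset\mathbb{R}^I$ with $\hat K<\infty$ be given, and let $(\hat\lambda,(\hat V,\hat\xi))$ be an optimal primal-dual solution pair of the corresponding approximation problem, i.e. $(\hat V,\hat\xi)$ is optimal for the linearized problem (AP) with fixed parameters $\hat{\vec\beta}_1,\dots,\hat{\vec\beta}_{\hat K}$, and $\hat\lambda$ is optimal for its dual (D). Define $$\hat v_t(\vec x)=\psi_t(\vec x)+\hat\xi_t-\sum_{k=1}^{\hat K}\hat V_{t,k}\,\phi(\vec x;\hat{\vec\beta}_k),\qquad t=1,\dots,\tau,\ \vec x\in\mathcal{X}_t,$$ and suppose $\hat v_1(\vec c)>v^*_1(\vec c)$. Let $\ell_t(\cdot;\hat\lambda)$ be the flow-imbalance functions parametrized by $\hat\lambda$. Then there exist $k\in\{1,\dots,K^*\}$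 and $t\in\{1,\dots,\tau\}$ such that $|\ell_t(\vec\beta^*_k;\hat\lambda)|>0$.
   Context: **Network revenue management (NRM) problem.** There are periods $t\in\{1,\dots,\tau\}$, products $j\in\{1,\dots,J\}$ and resources $i\in\{1,\dots,I\}$. In period $t$ product $j$ is requested with probability $p_{t,j}\ge 0$ (also written $p_{j,t}$), where $\sum_j p_{t,j}\le 1$; no request occurs with probability $1-\sum_j p_{t,j}$. Selling product $j$ yields revenue $f_j\in\mathbb{R}$ and consumes $\vec a_j=(a_{1j},\dots,a_{Ij})\in\{0,1\}^I$. Initial capacities are $\vec c=(c_1,\dots,c_I)$, nonnegative integers. The state sets are $\mathcal{X}_1=\{\vec c\}$ and $\mathcal{X}_t=\{0,\dots,c_1\}\times\dots\times\{0,\dots,c_I\}$ for $t\ge 2$. The feasible actions at $\vec x$ are $\mathcal{U}_{\vec x}=\{\vec u\in\{0,1\}^J: u_j\vec a_j\le\vec x\ \forall j\}$, and $\mathcal{F}_t=\{(\vec x,\vec u):\vec x\in\mathcal{X}_t,\ \vec u\in\mathcal{U}_{\vec x}\}$. **Optimal value function.** $v^*_\tau(\vec x)=\max_{\vec u\in\mathcal{U}_{\vec x}}\sum_j p_{\tau,j}f_ju_j$ for $\vec x\in\mathcal{X}_\tau$, and for $t<\tau$, $\vec x\in\mathcal{X}_t$, $$v^*_t(\vec x)=\max_{\vec u\in\mathcal{U}_{\vec x}}\Big\{\sum_j p_{t,j}[f_ju_j+v^*_{t+1}(\vec x-\vec a_ju_j)]+\Big(1-\sum_j p_{t,j}\Big)v^*_{t+1}(\vec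 x)\Big\}.$$ **Approximation.** $\psi_t:\mathcal{X}_t\to\mathbb{R}$ are given functions (baseline approximation) and $\phi:\mathbb{R}^I\times\mathbb{R}^I\to\mathbb{R}$, $(\vec x,\vec\beta)\mapsto\phi(\vec x;\vec\beta)$, is a given family of basis functions. **Linearized (AP).** For fixed $\vec\beta_1,\dots,\vec\beta_K\in\mathbb{R}^I$, write $v_t(\vec x)=\psi_t(\vec x)+\xi_t-\sum_{k=1}^K V_{t,k}\phi(\vec x;\vec\beta_k)$. The linearized (AP) is the linear program in the free real variables $\xi_t,V_{t,k}$: minimize $v_1(\vec c)$ subject to $$v_t(\vec x)\ge\sum_j p_{t,j}[f_ju_j+v_{t+1}(\vec x-\vec a_ju_j)]+\Big(1-\sum_j p_{t,j}\Big)v_{t+1}(\vec x)\quad\forall(\vec x,\vec u)\in\mathcal{F}_t,\ t=1,\dots,\tau-1,$$ $$v_\tau(\vec x)\ge\sum_j p_{\tau,j}f_ju_j\quad\forall(\vec x,\vec u)\in\mathcal{F}_\tau.$$ **Dual (D).** The linear programming dual, with variables $\lambda_{t,(\vec x,\vec u)}\ge 0$ for $(\vec x,\vec u)\in\mathcal{F}_t$, is (up to the additive constant $\psi_1(\vec c)$ in the objective): maximize $$\sum_{t=1}^{\tau-1}\sum_{(\vec x,\vec u)\in\mathcal{F}_t}\lambda_{t,(\vec x,\vec u)}\Big\{\sum_j p_{t,j}[f_ju_j+\psi_{t+1}(\vec x-\vec a_ju_j)]+\Big(1-\sum_j p_{t,j}\Big)\psi_{t+1}(\vec x)-\psi_t(\vec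 x)\Big\}+\sum_{(\vec x,\vec u)\in\mathcal{F}_\tau}\lambda_{\tau,(\vec x,\vec u)}\Big(\sum_j p_{\tau,j}f_ju_j-\psi_\tau(\vec x)\Big)$$ subject to $\sum_{(\vec x,\vec u)\in\mathcal{F}_t}\lambda_{t,(\vec x,\vec u)}=1$ if $t=1$ and $=\sum_{(\vec x,\vec u)\in\mathcal{F}_{t-1}}\lambda_{t-1,(\vec x,\vec u)}$ if $t\ge2$, and the flow-balance constraints $\ell_t(\vec\beta_k;\lambda)=0$ for all $t=1,\dots,\tau$, $k=1,\dots,K$, where $\ell_t$ is defined next. **Flow-imbalance functions.** For given $\lambda$ and $\vec\beta\in\mathbb{R}^I$, $$\ell_1(\vec\beta;\lambda)=\sum_{(\vec x,\vec u)\in\mathcal{F}_1}\phi(\vec x;\vec\beta)\lambda_{1,(\vec x,\vec u)}-\phi(\vec c;\vec\beta),$$ and for $t=2,\dots,\tau$, $$\ell_t(\vec\beta;\lambda)=\sum_{(\vec x,\vec u)\in\mathcal{F}_t}\phi(\vec x;\vec\beta)\lambda_{t,(\vec x,\vec u)}-\sum_{(\vec x,\vec u)\in\mathcal{F}_{t-1}}\Big(\sum_j p_{t-1,j}\phi(\vec x-\vec a_ju_j;\vec\beta)+\Big(1-\sum_j p_{t-1,j}\Big)\phi(\vec x;\vec\beta)\Big)\lambda_{t-1,(\vec x,\vec u)}.$$ *)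

(* Defs.v *)
From mathcomp Require Import all_boot all_order all_algebra.
From mathcomp Require Import reals.

Set Implicit Arguments.
Unset Strict Implicit.
Unset Printing Implicit Defensive.

Import Order.TTheory GRing.Theory Num.Theory.
Local Open Scope ring_scope.

(* Periods are natural numbers t with 1 <= t <= horizon; the values of
   period-indexed data outside this range are never used. *)
Record nrm (R : realType) := Nrm {
  horizon : nat;
  nprod : nat;
  nres : nat;
  prob : nat -> 'I_nprod -> R;
  revenue : 'I_nprod -> R;
  usage : 'I_nres -> 'I_nprod -> bool;
  cap : 'I_nres -> nat;
  horizon_gt0 : (0 < horizon)%N;
  prob_ge0 : forall t j, (1 <= t <= horizon)%N -> 0 <= prob t j;
  prob_le1 : forall t, (1 <= t <= horizon)%N -> \sum_j prob t j <= 1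
}.
Arguments prob {R} n t j.
Arguments cap {R} n i.

(* The whole type is the box {0..c_1} x ... x {0..c_I}. *)
Notation state P := {dffun forall i : 'I_(nres P), 'I_(cap P i).+1}.
Notation action P := {ffun 'I_(nprod P) -> bool}.

Definition full (R : realType) (P : nrm R) : state P :=
  [ffun i => (ord_max : 'I_(cap P i).+1)].

Definition nosale (R : realType) (P : nrm R) : action P := [ffun=> false].

Definition states (R : realType) (P : nrm R) (t : nat) : {set state P} :=
  if t == 1%N then [set full P] else [set: state P].

Definition actions (R : realType) (P : nrm R) (x : state P) :
    {set action P} :=
  [set u : action P | [forall j, forall i, (u j * usage i j <= x i)%N]].

Definition feas (R : realType) (P : nrm R) (t : nat) :
    {set state P * action P} :=
  [set xu | (xu.1 \in states P t) && (xu.2 \in actions xu.1)].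

(* x - a_j u_j. The subtraction on nat is truncated, but it is exact as soon
   as u is feasible at x (see val_after). *)
Definition after (R : realType) (P : nrm R) (x : state P) (u : action P)
    (j : 'I_(nprod P)) : state P :=
  [ffun i => (inord (x i - usage i j * u j)%N : 'I_(cap P i).+1)].

Lemma val_after (R : realType) (P : nrm R) (x : state P) (u : action P) j i :
  u \in actions x -> (after x u j i + usage i j * u j = x i)%N.
Proof.
rewrite inE => /forallP/(_ j)/forallP/(_ i) ux.
rewrite ffunE inordK; last exact: leq_ltn_trans (leq_subr _ _) (ltn_ord _).
by rewrite subnK // mulnC.
Qed.

Definition expect (R : realType) (P : nrm R) (t : nat) (g : state P -> R)
    (x : state P) (u : action P) : R :=
  \sum_j prob P t j * g (after x u j) + (1 - \sum_j prob P t j) * g x.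

Definition reward (R : realType) (P : nrm R) (t : nat) (u : action P) : R :=
  \sum_j prob P t j * revenue j * (u j)%:R.

Definition bellman (R : realType) (P : nrm R) (t : nat) (g : state P -> R)
    (x : state P) (u : action P) : R :=
  \sum_j prob P t j * (revenue j * (u j)%:R + g (after x u j))
  + (1 - \sum_j prob P t j) * g x.

(* The default value of the iterated maximum is attained at the action 0,
   which belongs to every feasible set (see maxactP). *)
Definition maxact (R : realType) (P : nrm R) (x : state P)
    (F : action P -> R) : R :=
  \big[Num.max/F (nosale P)]_(u in actions x) F u.

Lemma maxactP (R : realType) (P : nrm R) (x : state P) (F : action P -> R) :
  (exists2 u, u \in actions x & maxact x F = F u) /\
  (forall u, u \in actions x -> F u <= maxact x F).
Proof.
split; last by move=> u ux; rewrite /maxact; exact: le_bigmax_cond.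
rewrite /maxact; apply: (big_ind (fun m => exists2 u, u \in actions x & m = F u)).
- exists (nosale P) => //; rewrite inE.
  by apply/forallP=> j; apply/forallP=> i; rewrite ffunE.
- by move=> y z yP zP; rewrite /Num.max; case: ifP.
- by move=> u ux; exists u.
Qed.

(* Optimal value with n periods left after the current one. *)
Fixpoint vtogo (R : realType) (P : nrm R) (n : nat) : state P -> R :=
  if n is n'.+1 then
    fun x => maxact x (bellman (horizon P - n) (vtogo n') x)
  else fun x => maxact x (@reward R P (horizon P)).

Definition vopt (R : realType) (P : nrm R) (t : nat) : state P -> R :=
  @vtogo R P (horizon P - t).

Lemma vopt_last (R : realType) (P : nrm R) (x : state P) :
  vopt (horizon P) x = maxact x (@reward R P (horizon P)).
Proof. by rewrite /vopt subnn. Qed.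

Lemma vopt_rec (R : realType) (P : nrm R) (t : nat) (x : state P) :
  (t < horizon P)%N -> vopt t x = maxact x (bellman t (@vopt R P t.+1) x).
Proof.
by move=> tT; rewrite /vopt -(subnSK tT) /= subnSK // subKn // ltnW.
Qed.

Definition vecR (R : realType) (P : nrm R) (x : state P) : 'rV[R]_(nres P) :=
  \row_i (x i)%:R.

Definition vapx (R : realType) (P : nrm R) (psi : nat -> state P -> R)
    (phi : 'rV[R]_(nres P) -> 'rV[R]_(nres P) -> R)
    (K : nat) (beta : 'I_K -> 'rV[R]_(nres P))
    (xi : nat -> R) (V : nat -> 'I_K -> R) (t : nat) (x : state P) : R :=
  psi t x + xi t - \sum_k V t k * phi (vecR x) (beta k).

Definition AP_feasible (R : realType) (P : nrm R) (psi : nat -> state P -> R)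
    (phi : 'rV[R]_(nres P) -> 'rV[R]_(nres P) -> R)
    (K : nat) (beta : 'I_K -> 'rV[R]_(nres P))
    (xi : nat -> R) (V : nat -> 'I_K -> R) : Prop :=
  let v := vapx psi phi beta xi V in
  (forall t, (1 <= t < horizon P)%N -> forall x u, (x, u) \in feas P t ->
     v t x >= bellman t (v t.+1) x u) /\
  (forall x u, (x, u) \in feas P (horizon P) ->
     v (horizon P) x >= reward (horizon P) u).

Definition AP_optimal (R : realType) (P : nrm R) (psi : nat -> state P -> R)
    (phi : 'rV[R]_(nres P) -> 'rV[R]_(nres P) -> R)
    (K : nat) (beta : 'I_K -> 'rV[R]_(nres P))
    (xi : nat -> R) (V : nat -> 'I_K -> R) : Prop :=
  AP_feasible psi phi beta xi V /\
  (forall xi' V', AP_feasible psi phi beta xi' V' ->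
     vapx psi phi beta xi V 1 (full P) <= vapx psi phi beta xi' V' 1 (full P)).

Definition imbalance (R : realType) (P : nrm R)
    (phi : 'rV[R]_(nres P) -> 'rV[R]_(nres P) -> R) (t : nat)
    (beta : 'rV[R]_(nres P)) (lam : nat -> state P * action P -> R) : R :=
  let g (x : state P) := phi (vecR x) beta in
  \sum_(xu in feas P t) g xu.1 * lam t xu
  - (if t == 1%N then g (full P)
     else \sum_(xu in feas P t.-1) expect t.-1 g xu.1 xu.2 * lam t.-1 xu).

Definition D_objective (R : realType) (P : nrm R) (psi : nat -> state P -> R)
    (lam : nat -> state P * action P -> R) : R :=
  \sum_(1 <= t < horizon P) \sum_(xu in feas P t)
     lam t xu * (bellman t (psi t.+1) xu.1 xu.2 - psi t xu.1)
  + \sum_(xu in feas P (horizon P))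
     lam (horizon P) xu * (reward (horizon P) xu.2 - psi (horizon P) xu.1).

Definition D_feasible (R : realType) (P : nrm R)
    (phi : 'rV[R]_(nres P) -> 'rV[R]_(nres P) -> R)
    (K : nat) (beta : 'I_K -> 'rV[R]_(nres P))
    (lam : nat -> state P * action P -> R) : Prop :=
  [/\ forall t, (1 <= t <= horizon P)%N ->
        forall xu, xu \in feas P t -> 0 <= lam t xu,
      forall t, (1 <= t <= horizon P)%N ->
        \sum_(xu in feas P t) lam t xu =
        if t == 1%N then 1 else \sum_(xu in feas P t.-1) lam t.-1 xu
    & forall t k, (1 <= t <= horizon P)%N -> imbalance phi t (beta k) lam = 0].

Definition D_optimal (R : realType) (P : nrm R) (psi : nat -> state P -> R)
    (phi : 'rV[R]_(nres P) -> 'rV[R]_(nres P) -> R)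
    (K : nat) (beta : 'I_K -> 'rV[R]_(nres P))
    (lam : nat -> state P * action P -> R) : Prop :=
  D_feasible phi beta lam /\
  (forall lam', D_feasible phi beta lam' ->
     D_objective psi lam' <= D_objective psi lam).

(* Main.v *)
Require Import Defs.
From mathcomp Require Import all_boot all_order all_algebra.
From mathcomp Require Import reals boolp functions.
From mathcomp Require Import ring.

Set Implicit Arguments.
Unset Strict Implicit.
Unset Printing Implicit Defensive.

Import Order.TTheory GRing.Theory Num.Theory.
Local Open Scope ring_scope.

(** Suppose that every imbalance at the points [betastar k] vanishes. Then the
dual solution [lamhat] is also feasible for the dual program built on the
points [betastar k], whose mass and sign constraints are the same. The optimal
value function, by assumption a member of the approximation class spanned by
these points, is feasible for the corresponding primal program because it
satisfies the Bellman inequalities, so weak duality bounds the dual value of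
[lamhat] by its value [vopt 1 (full P)]. But [lamhat] is optimal for the dual
program built on the points [betahat k], so strong duality makes its dual value
equal to the optimal primal value [vapx psi phi betahat xihat Vhat 1 (full P)],
which exceeds [vopt 1 (full P)] by assumption: a contradiction.

Both duality statements rest on one summation by parts, [sum_drift]: for
arbitrary weights [lam] and an arbitrary family [g] of functions of the state,
the weighted sum of the one-period drifts of [g] equals the value of [g] at the
initial state plus the sum of its flow imbalances. Strong duality comes from
the algebraic Farkas lemma, [farkas], which turns primal optimality into
multipliers satisfying complementary slackness, [lp_multipliers]; testing these
multipliers against the coordinate directions of the variables [xi] and [V]
gives the mass and flow-balance constraints of the dual. *)

(** * Linear inequalities *)

(** Farkas' lemma for finitely many linear functionals on a vector space of
arbitrary dimension, by induction on the number of functionals (Bartl's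
argument). *)
Lemma farkas (R : realFieldType) (W : lmodType R) (I : eqType) (s : seq I)
    (A : I -> W -> R) (c : W -> R) :
  uniq s -> (forall i, scalar (A i)) -> scalar c ->
  (forall w, (forall i, i \in s -> 0 <= A i w) -> 0 <= c w) ->
  exists2 l : I -> R, (forall i, 0 <= l i) &
    forall w, c w = \sum_(i <- s) l i * A i w.
Proof.
elim: s A c => [|i s IHs] A c /= => [_ _ lc c0|/andP[i_s us] lA lc cA].
  exists (fun=> 0) => // w; rewrite big_nil.
  have cN : c (- w) = - c w.
    have c00 : c 0 = 0 by have := lc (-1) 0 0; rewrite scaler0 addr0 mulN1r addNr.
    by have := lc (-1) w 0; rewrite scaleN1r addr0 c00 addr0 mulN1r.
  by apply/eqP; rewrite eq_le -oppr_ge0 -cN !c0.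
(* Either the constraint i is redundant and gets multiplier 0, or some w
   satisfies all the other constraints with c w < 0. *)
have [cs|/existsNP[w /not_implyP[ws /negP]]] :=
    EM (forall w, (forall j, j \in s -> 0 <= A j w) -> 0 <= c w).
  have [l l0 lE] := IHs A c us lA lc cs.
  exists (fun j => if j == i then 0 else l j) => [j|w]; first by case: ifP.
  rewrite big_cons eqxx mul0r add0r lE; apply: eq_big_seq => j js.
  by case: eqP => // ji; rewrite -ji js in i_s.
rewrite -ltNge => cw.
have Aw : A i w < 0.
  rewrite ltNge; apply/negP => Aw; move: cw; rewrite ltNge => /negP; apply.
  by apply: cA => j; rewrite inE => /predU1P[->|/ws].
pose a := - (A i w)^-1; have a0 : 0 < a by rewrite oppr_gt0 invr_lt0.
have aA : a * A i w = -1 by rewrite mulNr mulVf // lt_eqF.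
(* Replacing v by v + (a * A i v) *: w projects along w onto the kernel of
   A i, where the i-th constraint is no longer needed. *)
pose A' j v := A j v + a * A j w * A i v.
pose c' v := c v + a * c w * A i v.
have [|||l l0 lE] := IHs A' c' us.
- by move=> j k u v; rewrite /A' !lA /=; ring.
- by move=> k u v; rewrite /c' lc lA /=; ring.
- move=> v vs; have -> : c' v = c ((a * A i v) *: w + v).
    by rewrite lc /c'; ring.
  apply: cA => j; rewrite inE lA => /predU1P[->|/vs].
    by rewrite mulrAC aA mulN1r addNr.
  by rewrite /A' addrC mulrAC.
pose S := \sum_(j <- s) l j * A j w.
have S0 : 0 <= S.
  by rewrite /S big_seq; apply: sumr_ge0 => j /ws ?; apply: mulr_ge0.
exists (fun j => if j == i then a * (S - c w) else l j) => [j|v].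
  case: ifP => // _; apply: mulr_ge0; first exact: ltW.
  by rewrite subr_ge0 (le_trans (ltW cw)).
have -> : \sum_(j <- i :: s) (if j == i then a * (S - c w) else l j) * A j v =
    a * (S - c w) * A i v + \sum_(j <- s) l j * A j v.
  rewrite big_cons eqxx; congr (_ + _); apply: eq_big_seq => j js.
  by case: eqP => // ji; rewrite -ji js in i_s.
have := lE v; rewrite /c' /A'.
have -> : \sum_(j <- s) l j * (A j v + a * A j w * A i v) =
    \sum_(j <- s) l j * A j v + S * (a * A i v).
  by rewrite /S mulr_suml -big_split; apply: eq_bigr => j _ /=; ring.
by move/eqP; rewrite eq_sym -subr_eq => /eqP <-; ring.
Qed.

(** Optimality conditions for a linear program with constraints [b i <= A i w]:
an optimal point [z] has nonnegative multipliers that represent the objective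
and satisfy complementary slackness. The program is homogenized by one extra
nonnegative variable, so that Farkas' lemma applies to W * R. *)
Lemma lp_multipliers (R : realFieldType) (W : lmodType R) (I : finType)
    (D : {pred I}) (A : I -> W -> R) (b : I -> R) (c : W -> R) (z : W) :
  (forall i, scalar (A i)) -> scalar c ->
  (forall i, i \in D -> b i <= A i z) ->
  (forall w, (forall i, i \in D -> b i <= A i w) -> c z <= c w) ->
  exists l : I -> R, [/\ forall i, 0 <= l i,
    forall w, c w = \sum_(i in D) l i * A i w
    & \sum_(i in D) l i * (b i - A i z) = 0].
Proof.
move=> lA lc zD cz.
pose A' (o : option I) (w : W * R^o) : R :=
  if o is Some i then A i w.1 + w.2 * (A i z - b i) else w.2.
pose c' (w : W * R^o) : R := c w.1.
pose s := None :: [seq Some i | i <- enum D].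
have mem_s i : (Some i \in s) = (i \in D).
  by rewrite inE /= mem_map ?mem_enum // => ? ? [].
have sZ (f : W -> R) a w : scalar f -> f (a *: w) = a * f w.
  move=> lf; have f0 : f 0 = 0.
    by have := lf (-1) 0 0; rewrite scaler0 addr0 mulN1r addNr.
  by have := lf a w 0; rewrite !addr0 f0 addr0.
have sD (f : W -> R) u w : scalar f -> f (u + w) = f u + f w.
  by move=> lf; have := lf 1 u w; rewrite scale1r mul1r.
have [||||l l0 lE] := @farkas R (W * R^o)%type _ s A' c'.
- rewrite /= map_inj_uniq ?enum_uniq ?andbT => [|? ? []//].
  by apply/mapP => -[].
- by move=> [i|] a [u u2] [v v2]; rewrite /A' /= ?lA // /GRing.scale /=; ring.
- by move=> a [u u2] [v v2]; rewrite /c' /= lc.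
- move=> [w t] ws; rewrite /c' /=.
  have t0 : 0 <= t by exact: (ws None).
  have wD i : i \in D -> 0 <= A i w + t * (A i z - b i).
    by rewrite -mem_s => /ws.
  have [tp|] := ltP 0 t.
    (* The point z + w / t is feasible. *)
    have := cz (t^-1 *: w + z); rewrite lc lerDr pmulr_rge0 ?invr_gt0 //; apply.
    move=> i /wD; rewrite lA -(@pmulr_rge0 _ t^-1) ?invr_gt0 // mulrDr mulrA.
    by rewrite mulVf ?gt_eqF // mul1r addrA subr_ge0.
  (* When t = 0, w is a recession direction and z + w is feasible. *)
  move=> tn; have tz : t = 0 by apply/le_anti; rewrite tn.
  have := cz (w + z); rewrite sD // lerDr; apply => i iD.
  rewrite sD // -[leLHS]add0r lerD ?zD //.
  by have := wD _ iD; rewrite tz mul0r addr0.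
have lE' w t : c w = l None * t +
    \sum_(i in D) l (Some i) * (A i w + t * (A i z - b i)).
  by have := lE (w, t); rewrite /c' big_cons big_map big_enum.
(* At (w, 0), lE' represents c w; at (0, 1), it says that l None minus the
   nonpositive slackness sum is 0, so that sum vanishes. *)
exists (l \o Some); split=> [i|w|] /=; first exact: l0.
  by rewrite (lE' w 0) mulr0 add0r; apply: eq_bigr => i _; rewrite mul0r addr0.
have f0 (f : W -> R) : scalar f -> f 0 = 0.
  by move=> lf; have := sZ f 0 0 lf; rewrite scaler0 mul0r.
have E : 0 = l None - \sum_(i in D) l (Some i) * (b i - A i z).
  rewrite -[LHS](f0 c lc) (lE' 0 1) mulr1 -sumrN; congr (_ + _).
  by apply: eq_bigr => i _; rewrite (f0 _ (lA i)) add0r mul1r -mulrN opprB.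
apply/le_anti/andP; split.
  by apply: sumr_le0 => i iD; rewrite mulr_ge0_le0 ?subr_le0 ?zD.
by move/eqP: E; rewrite eq_sym subr_eq0 => /eqP <-.
Qed.

(** * Drifts and flows *)

Section NRM.
Variables (R : realType) (P : nrm R).
Local Notation T := (horizon P).
Local Notation vec := 'rV[R]_(nres P).
Implicit Types (g : nat -> state P -> R) (xu : state P * action P).
Implicit Types (lam : nat -> state P * action P -> R).
Implicit Types (phi : vec -> vec -> R) (psi : nat -> state P -> R).

(** Expected one-period decrease of [g] from the state-action pair [xu]; after
the last period the value is 0. *)
Definition drift g t xu : R :=
  g t xu.1 - (if (t < T)%N then expect t (g t.+1) xu.1 xu.2 else 0).

(** The flow imbalance of an arbitrary function [h] of the state: [imbalance] is
the case of a basis function. *)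
Definition flow t (h : state P -> R) lam : R :=
  \sum_(xu in feas P t) h xu.1 * lam t xu
  - (if t == 1%N then h (full P)
     else \sum_(xu in feas P t.-1) expect t.-1 h xu.1 xu.2 * lam t.-1 xu).

(** The part of the approximation [vapx] that is linear in its parameters. *)
Definition lin phi K (beta : 'I_K -> vec) (xi : nat -> R)
  (V : nat -> 'I_K -> R) t (x : state P) : R :=
  xi t - \sum_k V t k * phi (vecR x) (beta k).

Lemma bellmanE t (h : state P -> R) x u :
  bellman t h x u = reward t u + expect t h x u.
Proof.
rewrite /bellman /reward /expect addrA -big_split; congr (_ + _).
by apply: eq_bigr => j _ /=; rewrite mulrDr mulrA.
Qed.

Lemma vapx_lin psi phi K (beta : 'I_K -> vec) xi V t x :
  vapx psi phi beta xi V t x = psi t x + lin phi beta xi V t x.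
Proof. by rewrite /vapx addrA. Qed.

Lemma expectD t (h h' : state P -> R) a x u :
  expect t (fun y => a * h y + h' y) x u = a * expect t h x u + expect t h' x u.
Proof.
rewrite /expect.
have -> : \sum_j prob P t j * (a * h (after x u j) + h' (after x u j)) =
    a * (\sum_j prob P t j * h (after x u j)) +
    \sum_j prob P t j * h' (after x u j).
  by rewrite mulr_sumr -big_split; apply: eq_bigr => j _ /=; ring.
ring.
Qed.

Lemma expect_cst t a (x : state P) u : expect t (fun=> a) x u = a.
Proof. by rewrite /expect -mulr_suml -mulrDl addrC subrK mul1r. Qed.

Lemma driftD g g' a t xu :
  drift (fun s y => a * g s y + g' s y) t xu = a * drift g t xu + drift g' t xu.
Proof. by rewrite /drift; case: ifP => _; rewrite ?expectD; ring. Qed.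

Lemma eq_expect t (h h' : state P -> R) : h =1 h' -> expect t h =2 expect t h'.
Proof.
by move=> hh' x u; rewrite /expect hh'; under eq_bigr do rewrite hh'.
Qed.

Lemma eq_drift g g' : (forall t x, g t x = g' t x) -> drift g =2 drift g'.
Proof.
move=> gg' t xu; by rewrite /drift gg' (eq_expect _ (gg' t.+1)).
Qed.

(** The terminal constraint has the same form as the others, since the drift in
the last period is the value itself. *)
Lemma AP_feasibleP psi phi K (beta : 'I_K -> vec) xi V :
  AP_feasible psi phi beta xi V <->
  forall t xu, (1 <= t <= T)%N -> xu \in feas P t ->
    reward t xu.2 <= drift (vapx psi phi beta xi V) t xu.
Proof.
split=> [[vb vT] t [x u] /= /andP[t1]|vD].
  rewrite leq_eqVlt /drift => /predU1P[->|tT] xuF.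
    by rewrite ltnn subr0; exact: vT.
  by rewrite tT lerBrDr -bellmanE; apply: vb; rewrite ?t1.
split=> [t /andP[t1 tT] x u xuF|x u xuF].
  have := vD t (x, u); rewrite t1 (ltnW tT) /drift tT lerBrDr -bellmanE.
  exact.
have := vD T (x, u); rewrite leqnn horizon_gt0 /drift ltnn subr0; exact.
Qed.

(** Summation by parts over the periods: the expected next values in period [t]
are regrouped with the values in period [t.+1]. *)
Lemma sum_drift lam g :
  \sum_(1 <= t < T.+1) \sum_(xu in feas P t) lam t xu * drift g t xu =
  g 1%N (full P) + \sum_(1 <= t < T.+1) flow t (g t) lam.
Proof.
pose S t := \sum_(xu in feas P t) g t xu.1 * lam t xu.
pose E t := \sum_(xu in feas P t) expect t (g t.+1) xu.1 xu.2 * lam t xu.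
have -> : \sum_(1 <= t < T.+1) \sum_(xu in feas P t) lam t xu * drift g t xu =
    \sum_(1 <= t < T.+1) (S t - (if (t < T)%N then E t else 0)).
  apply: eq_bigr => t _; rewrite /drift /S /E; case: ifP => _.
    by rewrite -sumrB; apply: eq_bigr => xu _; ring.
  by rewrite subr0; apply: eq_bigr => xu _; ring.
rewrite [in RHS]/flow !sumrB addrCA; congr (_ + _).
have T0 := horizon_gt0 P.
rewrite big_nat_recr //= ltnn addr0 [in RHS]big_ltn //= opprD addrA subrr add0r.
rewrite [in RHS]big_add1 /=; congr (- _).
by apply: eq_big_nat => t /andP[t1 ->]; case: eqP => // -[t0]; rewrite t0 in t1.
Qed.

Lemma D_objectiveE psi lam :
  D_objective psi lam = \sum_(1 <= t < T.+1) \sum_(xu in feas P t)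
    lam t xu * (reward t xu.2 - drift psi t xu).
Proof.
rewrite /D_objective big_nat_recr ?horizon_gt0 //=; congr (_ + _).
  rewrite big_nat_cond [RHS]big_nat_cond; apply: eq_bigr => t.
  rewrite andbT => /andP[_ tT]; apply: eq_bigr => xu _.
  by rewrite bellmanE /drift tT; ring.
by apply: eq_bigr => xu _; rewrite /drift ltnn subr0.
Qed.

Lemma flowD t h h' a lam :
  flow t (fun x => a * h x + h' x) lam = a * flow t h lam + flow t h' lam.
Proof.
have sumD s (F F' : state P * action P -> R) :
    \sum_(xu in feas P s) (a * F xu + F' xu) * lam s xu =
    a * (\sum_(xu in feas P s) F xu * lam s xu) +
    \sum_(xu in feas P s) F' xu * lam s xu.
  by rewrite mulr_sumr -big_split; apply: eq_bigr => xu _ /=; ring.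
rewrite /flow sumD; case: ifP => _; first by ring.
by under [X in _ - X = _]eq_bigr do rewrite expectD; rewrite sumD; ring.
Qed.

Lemma flow_sum t (K : Type) (r : seq K) (a : K -> R) (h : K -> state P -> R) lam :
  flow t (fun x => \sum_(k <- r) a k * h k x) lam =
  \sum_(k <- r) a k * flow t (h k) lam.
Proof.
elim: r => [|k r IHr].
  rewrite big_nil.
  have -> : (fun x : state P => \sum_(k <- [::]) a k * h k x) =
            (fun x => -1 * 0 + 0).
    by apply/funext => x; rewrite big_nil mulr0 addr0.
  by rewrite (flowD _ (fun=> 0) (fun=> 0)) mulN1r addNr.
rewrite big_cons -IHr -flowD; congr (flow t _ lam).
by apply/funext => x; rewrite big_cons.
Qed.

Lemma flow_lin phi K (beta : 'I_K -> vec) xi V lam t :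
  flow t (lin phi beta xi V t) lam =
  xi t * flow t (fun=> 1) lam - \sum_k V t k * imbalance phi t (beta k) lam.
Proof.
have -> : lin phi beta xi V t = (fun x => xi t * 1 +
    \sum_k (- V t k) * phi (vecR x) (beta k)).
  apply/funext => x; rewrite /lin mulr1 -sumrN; congr (_ + _).
  by apply: eq_bigr => k _; rewrite mulNr.
rewrite (flowD _ (fun=> 1)) flow_sum -sumrN; congr (_ + _).
by apply: eq_bigr => k _; rewrite mulNr.
Qed.

Lemma flow1 lam t :
  flow t (fun=> 1) lam =
  \sum_(xu in feas P t) lam t xu -
  if t == 1%N then 1 else \sum_(xu in feas P t.-1) lam t.-1 xu.
Proof.
rewrite /flow; congr (_ - _); first by apply: eq_bigr => ? _; rewrite mul1r.
by case: ifP => // _; apply: eq_bigr => xu _; rewrite expect_cst mul1r.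
Qed.

(** * Duality *)

(** At a feasible dual point, the dual value is the Lagrangian of the primal
program, whatever the primal parameters [xi] and [V]. *)
Lemma D_objective_lagrangian psi phi K (beta : 'I_K -> vec) xi V lam :
  D_feasible phi beta lam ->
  D_objective psi lam + psi 1%N (full P) =
  vapx psi phi beta xi V 1 (full P) +
  \sum_(1 <= t < T.+1) \sum_(xu in feas P t)
     lam t xu * (reward t xu.2 - drift (vapx psi phi beta xi V) t xu).
Proof.
move=> [_ lam_bal lam_imb].
have lin0 : \sum_(1 <= t < T.+1) \sum_(xu in feas P t)
    lam t xu * drift (lin phi beta xi V) t xu = lin phi beta xi V 1 (full P).
  rewrite sum_drift big1_seq ?addr0 // => t /=.
  rewrite mem_index_iota ltnS => tT.
  rewrite flow_lin flow1 lam_bal // subrr mulr0 sub0r big1 ?oppr0 //.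
  by move=> k _; rewrite lam_imb ?mulr0.
rewrite D_objectiveE vapx_lin -lin0 -addrA [RHS]addrC; congr (_ + _).
rewrite -big_split; apply: eq_bigr => t _ /=.
rewrite -big_split; apply: eq_bigr => xu _ /=.
have -> : drift (vapx psi phi beta xi V) t xu =
    1 * drift psi t xu + drift (lin phi beta xi V) t xu.
  by rewrite -driftD; apply: eq_drift => s x; rewrite mul1r vapx_lin.
ring.
Qed.

Lemma weak_duality psi phi K (beta : 'I_K -> vec) xi V lam :
  D_feasible phi beta lam -> AP_feasible psi phi beta xi V ->
  D_objective psi lam + psi 1%N (full P) <= vapx psi phi beta xi V 1 (full P).
Proof.
move=> lamD /AP_feasibleP vD; rewrite (D_objective_lagrangian _ xi V lamD).
rewrite gerDl big_seq; apply: sumr_le0 => t.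
rewrite mem_index_iota ltnS => tT; apply: sumr_le0 => xu xuF.
by case: lamD => lam0 _ _; rewrite mulr_ge0_le0 ?lam0 // subr_le0 vD.
Qed.

Lemma strong_duality psi phi K (beta : 'I_K -> vec) xi V :
  AP_optimal psi phi beta xi V ->
  exists2 lam, D_feasible phi beta lam &
    D_objective psi lam + psi 1%N (full P) = vapx psi phi beta xi V 1 (full P).
Proof.
move=> [/AP_feasibleP vD vmin].
pose W := ((nat -> R^o) * (nat -> 'I_K -> R^o))%type.
pose w (d : W) := lin phi beta d.1 d.2.
pose D := [pred i : 'I_T.+1 * (state P * action P) |
  (1 <= i.1)%N && (i.2 \in feas P i.1)].
pose A (i : 'I_T.+1 * (state P * action P)) (d : W) := drift (w d) i.1 i.2.
pose b (i : 'I_T.+1 * (state P * action P)) : R :=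
  reward i.1 i.2.2 - drift psi i.1 i.2.
have wD a d d' t x : w (a *: d + d') t x = a * w d t x + w d' t x.
  rewrite /w /lin /= mulrBr addrACA -opprD; congr (_ - _).
  by rewrite mulr_sumr -big_split; apply: eq_bigr => k _; rewrite /= mulrDl mulrA.
have vE d t xu : drift (vapx psi phi beta d.1 d.2) t xu =
    drift psi t xu + drift (w d) t xu.
  rewrite -[drift psi t xu]mul1r -driftD.
  by apply: eq_drift => s x; rewrite mul1r vapx_lin.
have AP_D (d : W) : (forall i, i \in D -> b i <= A i d) <->
    AP_feasible psi phi beta d.1 d.2.
  rewrite AP_feasibleP; split=> [bA t xu /andP[t1 tT] xuF|vd i].
    rewrite vE -lerBlDl; rewrite -ltnS in tT.
    by apply: (bA (Ordinal tT, xu)); rewrite inE /= t1.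
  rewrite inE => /andP[i1 iF]; rewrite /b lerBlDl -vE.
  by apply: vd => //; rewrite i1 -ltnS ltn_ord.
have [||||l [l0 lw lb]] :=
    @lp_multipliers R W _ D A b (fun d => w d 1%N (full P)) (xi, V).
- move=> i a d d'; rewrite /A -driftD; apply: eq_drift => t x; exact: wD.
- by move=> a d d'; rewrite wD.
- exact/AP_D/AP_feasibleP.
- by move=> d /AP_D /vmin; rewrite !vapx_lin lerD2l.
(* Only the periods 1 <= t <= T matter; on them inord keeps the value of t. *)
pose lam t xu := l (inord t, xu).
have sumE (F : nat -> state P * action P -> R) :
    \sum_(i in D) l i * F i.1 i.2 =
    \sum_(1 <= t < T.+1) \sum_(xu in feas P t) lam t xu * F t xu.
  rewrite big_geq_mkord /= pair_big_dep /=; apply: eq_bigr => -[t xu] _ /=.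
  by rewrite /lam inord_val.
(* The representation of the objective, rearranged by sum_drift, says that the
   flows vanish in total; a direction supported on a single period, and on a
   single basis function, isolates one dual constraint. *)
have flow0 (d : W) : \sum_(1 <= t < T.+1) flow t (w d t) lam = 0.
  have := lw d; rewrite (sumE (drift (w d))) sum_drift => /eqP.
  by rewrite -subr_eq0 opprD addNKr oppr_eq0 => /eqP.
have pick t (F : nat -> R) : (1 <= t <= T)%N ->
    (forall s, s != t -> F s = 0) -> \sum_(1 <= s < T.+1) F s = F t.
  move=> tT F0; rewrite (bigD1_seq t) ?iota_uniq ?mem_index_iota //=.
  by rewrite big1 ?addr0.
have lamD : D_feasible phi beta lam.
  split=> [t _ xu _|t tT|t k tT]; first exact: l0.
    have := flow0 ((fun s => (s == t)%:R), (fun _ _ => 0)).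
    rewrite (pick t) // => [|s /negPf st]; rewrite flow_lin /=.
      rewrite eqxx mul1r big1 ?subr0 => [|k _]; last by rewrite mul0r.
      by rewrite flow1 => /eqP; rewrite subr_eq0 => /eqP.
    by rewrite st mul0r big1 ?subr0 // => k _; rewrite mul0r.
  have := flow0 ((fun=> 0), (fun s k' => ((s == t) && (k' == k))%:R)).
  rewrite (pick t) // => [|s /negPf st]; rewrite flow_lin /= mul0r sub0r.
    rewrite (bigD1 k) //= !eqxx mul1r big1 ?addr0 => [/eqP|k' /negPf->].
      by rewrite oppr_eq0 => /eqP.
    by rewrite andbF mul0r.
  by rewrite st big1 ?oppr0 // => k' _; rewrite mul0r.
exists lam => //.
rewrite (D_objective_lagrangian _ xi V lamD) -[RHS]addr0; congr (_ + _).
rewrite -(sumE (fun t xu => reward t xu.2 - drift (vapx psi phi beta xi V) t xu)).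
rewrite -[RHS]lb; apply: eq_bigr => i _.
by rewrite (vE (xi, V)) opprD addrA.
Qed.

Lemma vopt_AP_feasible psi phi K (beta : 'I_K -> vec) xi V :
  (forall t, (1 <= t <= T)%N -> forall x : state P, x \in states P t ->
     vopt t x = vapx psi phi beta xi V t x) ->
  AP_feasible psi phi beta xi V.
Proof.
move=> vE; apply/AP_feasibleP => t [x u] tT; rewrite inE => /andP[/= xt ux].
rewrite /drift /= -vE //; case/andP: tT => t1; rewrite leq_eqVlt.
case/predU1P=> [->|tT].
  by rewrite ltnn subr0 vopt_last; case: (maxactP x (@reward R P T)) => _; apply.
have vE1 y : vapx psi phi beta xi V t.+1 y = vopt t.+1 y.
  rewrite vE ?tT // /states.
  by case: eqP => [[t0]|_]; [rewrite t0 in t1|rewrite inE].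
rewrite tT lerBrDr (eq_expect _ vE1) -bellmanE vopt_rec //.
by case: (maxactP x (bellman t (@vopt R P t.+1) x)) => _; apply.
Qed.
End NRM.

(** * Nonzero imbalance *)

Theorem theorem1 (R : realType) (P : nrm R) (psi : nat -> state P -> R)
    (phi : 'rV[R]_(nres P) -> 'rV[R]_(nres P) -> R)
    (Kstar : nat) (xistar : nat -> R) (Vstar : nat -> 'I_Kstar -> R)
    (betastar : 'I_Kstar -> 'rV[R]_(nres P))
    (hstar : forall t, (1 <= t <= horizon P)%N ->
       forall x : state P, x \in states P t ->
         vopt t x = vapx psi phi betastar xistar Vstar t x)
    (Khat : nat) (betahat : 'I_Khat -> 'rV[R]_(nres P))
    (xihat : nat -> R) (Vhat : nat -> 'I_Khat -> R)
    (lamhat : nat -> state P * action P -> R)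
    (hprimal : AP_optimal psi phi betahat xihat Vhat)
    (hdual : D_optimal psi phi betahat lamhat)
    (hgap : vapx psi phi betahat xihat Vhat 1 (full P) > vopt 1 (full P)) :
  exists (k : 'I_Kstar) (t : nat),
    (1 <= t <= horizon P)%N /\ `|imbalance phi t (betastar k) lamhat| > 0.
Proof.
apply/not_existsP => no_imb; move: hgap; apply/negP; rewrite -leNgt.
have T0 := horizon_gt0 P.
have [[lam0 lam_bal _] lam_max] := hdual.
have lamD : D_feasible phi betastar lamhat.
  split=> // t k tT; apply/eqP; rewrite -normr_le0 leNgt; apply/negP => imb.
  by apply: (no_imb k); exists t.
have [lam lamF <-] := strong_duality hprimal.
rewrite hstar ?inE //; apply: le_trans (weak_duality lamD (vopt_AP_feasible hstar)).
by rewrite lerD2r lam_max.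
Qed.
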